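(* Let $0\le \alpha\le 1$ and let $f(z)=z+a_2z^2+a_3z^3+\cdots$ be analytic in $\Delta=\{z\in\mathbb{C}:|z|<1\}$ with $f\in\mathcal{SK}(\alpha)$. Then \[ \mathrm{Re}\left(\frac{f(z)}{z}\right)>\gamma(\alpha):=\frac{2\alpha^2+3\alpha+9}{3(\alpha^2+3\alpha+6)}\qquad(z\in\Delta). \]
   Context: For analytic $F,G$ on $\Delta$, $F\prec G$ ($F$ is subordinate to $G$) means there is an analytic $w:\Delta\to\Delta$ with $w(0)=0$ such that $F(z)=G(w(z))$ for all $z\in\Delta$. For $\alpha\in(-3,1]$ let $\widetilde{q}_\alpha(z)=\dfrac{3}{3+(\alpha-3)z-\alpha z^2}$ ($z\in\Delta$). The class $\mathcal{SK}(\alpha)$ consists of all analytic $f$ on $\Delta$ with $f(0)=0$, $f'(0)=1$, such that $\dfrac{zf'(z)}{f(z)}\prec \widetilde{q}_\alpha(z)$ in $\Delta$. *)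

(* Defs.v *)
From Stdlib Require Import Reals.
From Coquelicot Require Import Coquelicot.
Open Scope R_scope.

Definition in_disc (z : C) : Prop := Cmod z < 1.

Definition Cis_derive (f : C -> C) (z l : C) : Prop :=
  @is_derive C_AbsRing C_NormedModule f z l.

Definition analytic_disc (f : C -> C) : Prop :=
  forall z, in_disc z -> exists l : C, Cis_derive f z l.

Definition subordinate (F G : C -> C) : Prop :=
  analytic_disc F /\ analytic_disc G /\
  exists w : C -> C,
    analytic_disc w /\ (forall z, in_disc z -> in_disc (w z)) /\ w 0 = 0 /\
    forall z, in_disc z -> F z = G (w z).

Definition qt (alpha : R) (z : C) : C :=
  Cdiv (RtoC 3) (RtoC 3 + RtoC (alpha - 3) * z - RtoC alpha * (z * z))%C.

(* z f'(z) / f(z) on Delta, with its removable-singularity value 1 at z = 0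
   (for f(0)=0, f'(0)=1) *)
Definition zfp_over_f (f f' : C -> C) (z : C) : C :=
  if Ceq_dec z 0 then RtoC 1 else Cdiv (z * f' z)%C (f z).

(* f(z)/z on Delta, with its removable-singularity value f'(0) = 1 at z = 0 *)
Definition f_over_z (f : C -> C) (z : C) : C :=
  if Ceq_dec z 0 then RtoC 1 else Cdiv (f z) z.

Definition SK (alpha : R) (f : C -> C) : Prop :=
  exists f' : C -> C,
    (forall z, in_disc z -> Cis_derive f z (f' z)) /\
    f 0 = 0 /\ f' 0 = RtoC 1 /\
    subordinate (zfp_over_f f f') (qt alpha).

Definition gamma (alpha : R) : R :=
  (2 * alpha ^ 2 + 3 * alpha + 9) / (3 * (alpha ^ 2 + 3 * alpha + 6)).

(* Main.v *)
Require Import Defs.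
From Stdlib Require Import Reals Lra Classical ClassicalEpsilon.
From Coquelicot Require Import Coquelicot.
Open Scope R_scope.

(** For [0 <= alpha <= 1] subordination gives [Re P > 1/2] for [P = z f' / f],
    and [gamma alpha <= 1/2], so it suffices that a function starlike of order
    [1/2] satisfies [Re (f(z)/z) > 1/2], i.e. [|1 - z/f(z)| < 1]. This follows
    from [|phi| <= 1] for [phi = 1/z - 1/f], by Jack's argument: if [|phi| > 1]
    somewhere, maximize [|phi|^2 + eps (log |z| + |z|)] over a closed disc of
    radius [R] close to 1. Positivity of the Laplacian forces the maximum onto
    [|z| = R]; there [z phi' / phi] is real and almost nonnegative, which
    contradicts [Re P > 1/2]. No Cauchy theory is needed: as [f' = P f / z] with
    [P] holomorphic, [f] has the two derivatives used in the maximum principle. *)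

(** * Differentiation and maxima in real variables *)

Lemma Cis_derive_eps (F : C -> C) (z l : C) :
  Cis_derive F z l -> forall eps : posreal, exists d : posreal,
  forall w, Cmod (w - z) < d ->
    Cmod (F w - F z - l * (w - z))%C <= eps * Cmod (w - z).
Proof.
  intros [_ H] eps.
  destruct (H z (fun P HP => HP) eps) as [d Hd].
  exists d; intros w Hw.
  replace (l * (w - z))%C with ((w - z) * l)%C by ring.
  exact (Hd w Hw).
Qed.

Lemma Cmod_minus_lt (x y u v d : R) :
  Rabs (u - x) < d / 2 -> Rabs (v - y) < d / 2 -> Cmod ((u, v) - (x, y))%C < d.
Proof.
  intros Hu Hv.
  assert (H : ((u, v) - (x, y))%C = (RtoC (u - x) + Ci * RtoC (v - y))%C).
  { apply injective_projections; cbn; ring. }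
  rewrite H.
  eapply Rle_lt_trans; [apply Cmod_triangle|].
  rewrite Cmod_mult, !Cmod_R.
  assert (Cmod Ci = 1) as ->.
  { unfold Cmod; cbn [fst snd Ci].
    replace (0 ^ 2 + 1 ^ 2) with 1 by ring; exact sqrt_1. }
  lra.
Qed.

(** Cauchy-Riemann: multiplication by [l] is the real matrix with rows [(Re l, - Im l)] and
    [(Im l, Re l)], and the complex remainder dominates each of its two components. *)
Lemma Cis_derive_differentiable (F : C -> C) (x y : R) (l : C) :
  Cis_derive F (x, y) l ->
  differentiable_pt_lim (fun u v => Re (F (u, v))) x y (Re l) (- Im l) /\
  differentiable_pt_lim (fun u v => Im (F (u, v))) x y (Im l) (Re l).
Proof.
  intros H.
  assert (K : forall eps : posreal, locally_2d (fun u v =>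
    Cmod (F (u, v) - F (x, y) - l * ((u, v) - (x, y)))%C
      <= eps * Rmax (Rabs (u - x)) (Rabs (v - y))) x y).
  { intros eps.
    assert (He : 0 < eps / 2) by (destruct eps; cbn; lra).
    destruct (Cis_derive_eps _ _ _ H (mkposreal _ He)) as [d Hd].
    assert (Hd2 : 0 < d / 2) by (destruct d; cbn; lra).
    exists (mkposreal _ Hd2); cbn; intros u v Hu Hv.
    eapply Rle_trans; [apply Hd, Cmod_minus_lt; assumption|]; cbn [pos].
    assert (Cmod ((u, v) - (x, y)) <= 2 * Rmax (Rabs (u - x)) (Rabs (v - y))).
    { eapply Rle_trans; [apply Cmod_2Rmax|].
      change (fst ((u, v) - (x, y))%C) with (u + - x).
      change (snd ((u, v) - (x, y))%C) with (v + - y).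
      apply Rmult_le_compat_r.
      - eapply Rle_trans; [apply Rabs_pos|apply Rmax_l].
      - rewrite <- (sqrt_square 2) at 2 by lra. apply sqrt_le_1; lra. }
    destruct eps as [e e0]; cbn in *; nra. }
  split; intros eps; destruct (K eps) as [d Hd]; exists d; intros u v Hu Hv;
    (eapply Rle_trans; [|apply (Hd u v Hu Hv)]);
    (eapply Rle_trans; [|apply Rmax_Cmod]).
  - eapply Rle_trans; [|apply Rmax_l]; apply Req_le; f_equal;
      destruct l, (F (u, v)), (F (x, y)); cbn; ring.
  - eapply Rle_trans; [|apply Rmax_r]; apply Req_le; f_equal;
      destruct l, (F (u, v)), (F (x, y)); cbn; ring.
Qed.

Lemma continuous_2d_max (F : R -> R -> R) (a b c d : R) :
  a <= b -> c <= d ->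
  (forall x y, a <= x <= b -> c <= y <= d -> continuity_2d_pt F x y) ->
  exists x0 y0, a <= x0 <= b /\ c <= y0 <= d /\
    forall x y, a <= x <= b -> c <= y <= d -> F x y <= F x0 y0.
Proof.
  intros Hab Hcd HF.
  (* Choosing the radius [delta] below [1 / (|G| + 1)] turns the uniform lower
     bound on [delta] given by compactness into an upper bound on [G]. *)
  assert (bounded : forall G : R -> R -> R,
    (forall x y, a <= x <= b -> c <= y <= d -> continuity_2d_pt G x y) ->
    exists M, forall x y, a <= x <= b -> c <= y <= d -> G x y <= M).
  { intros G HG.
    assert (Hdelta : forall x y, exists e : posreal,
      a <= x <= b -> c <= y <= d ->
      e <= / (Rabs (G x y) + 1) /\
      forall u v, Rabs (u - x) < e -> Rabs (v - y) < e -> G u v < G x y + 1).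
    { intros x y.
      assert (Hp : 0 < / (Rabs (G x y) + 1)).
      { apply Rinv_0_lt_compat. pose proof (Rabs_pos (G x y)); lra. }
      destruct (classic (a <= x <= b /\ c <= y <= d)) as [[Hx Hy]|Hn].
      - destruct (HG x y Hx Hy (mkposreal 1 Rlt_0_1)) as [e He].
        assert (Hm : 0 < Rmin e (/ (Rabs (G x y) + 1))).
        { apply Rmin_glb_lt; [apply e|exact Hp]. }
        exists (mkposreal _ Hm); intros _ _; cbn; split; [apply Rmin_r|].
        intros u v Hu Hv.
        assert (K : Rabs (G u v - G x y) < 1).
        { apply He; eapply Rlt_le_trans; eauto; apply Rmin_l. }
        apply Rabs_def2 in K; lra.
      - exists (mkposreal 1 Rlt_0_1); tauto. }
    set (delta := fun x y => proj1_sig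
      (constructive_indefinite_description _ (Hdelta x y))).
    assert (Hd : forall x y, a <= x <= b -> c <= y <= d ->
      delta x y <= / (Rabs (G x y) + 1) /\
      forall u v, Rabs (u - x) < delta x y -> Rabs (v - y) < delta x y ->
        G u v < G x y + 1).
    { intros x y; unfold delta.
      exact (proj2_sig (constructive_indefinite_description _ (Hdelta x y))). }
    destruct (compactness_value_2d a b c d delta) as [e He].
    exists (/ e + 1); intros x y Hx Hy.
    apply NNPP; intros Hn; apply (He x y Hx Hy).
    intros (u & v & Hu & Hv & Hxu & Hyv & Hle).
    destruct (Hd u v Hu Hv) as [H1 H2].
    specialize (H2 x y Hxu Hyv).
    assert (Hp : 0 < Rabs (G u v) + 1) by (pose proof (Rabs_pos (G u v)); lra).
    assert (Rabs (G u v) + 1 <= / e).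
    { rewrite <- (Rinv_inv (Rabs (G u v) + 1)).
      apply Rinv_le_contravar; [apply e|lra]. }
    pose proof (Rle_abs (G u v)); lra. }
  destruct (bounded F HF) as [M HM].
  set (S := fun r => exists x y, a <= x <= b /\ c <= y <= d /\ r = F x y).
  destruct (completeness S) as [s [Hs1 Hs2]].
  { exists M; intros r (x & y & Hx & Hy & ->); auto. }
  { exists (F a c), a, c; repeat split; lra. }
  assert (Hle : forall x y, a <= x <= b -> c <= y <= d -> F x y <= s).
  { intros x y Hx Hy; apply Hs1; exists x, y; auto. }
  (* If the supremum [s] is not attained, [/ (s - F)] is continuous on the rectangle, hence bounded
     by some [K]. Then [F <= s - / K] everywhere, against the choice of [s]. *)
  apply NNPP; intros Hn.
  assert (Hlt : forall x y, a <= x <= b -> c <= y <= d -> F x y < s).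
  { intros x y Hx Hy. destruct (Hle x y Hx Hy) as [|E]; [assumption|].
    exfalso; apply Hn; exists x, y; split; [|split]; auto.
    intros; rewrite E; auto. }
  destruct (bounded (fun x y => / (s - F x y))) as [K HK].
  { intros x y Hx Hy.
    apply continuity_2d_pt_inv; [|specialize (Hlt x y Hx Hy); lra].
    apply continuity_2d_pt_minus; [apply continuity_2d_pt_const|auto]. }
  assert (K0 : 0 < K).
  { eapply Rlt_le_trans; [|apply (HK a c); lra].
    apply Rinv_0_lt_compat. assert (F a c < s) by (apply Hlt; lra). lra. }
  assert (s <= s - / K).
  { apply Hs2; intros r (x & y & Hx & Hy & ->).
    specialize (HK x y Hx Hy); specialize (Hlt x y Hx Hy).
    assert (/ K <= s - F x y).
    { rewrite <- (Rinv_inv (s - F x y)).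
      apply Rinv_le_contravar; [apply Rinv_0_lt_compat; lra|exact HK]. }
    lra. }
  pose proof (Rinv_0_lt_compat K K0); lra.
Qed.

(** Difference quotients from the left are nonnegative. The one-sided form serves a maximum on the
    outer edge of the annulus, where only smaller radii can be compared. *)
Lemma is_derive_left_max (g : R -> R) (x l d : R) :
  is_derive g x l -> 0 < d -> (forall y, x - d < y <= x -> g y <= g x) -> 0 <= l.
Proof.
  intros Hg Hd H.
  apply is_derive_Reals in Hg.
  destruct (Rle_lt_dec 0 l) as [|Hl]; [assumption|exfalso].
  assert (Hl2 : 0 < - l) by lra.
  destruct (Hg (- l) Hl2) as [e He].
  set (h := Rmin d e / 2).
  assert (Hm : 0 < Rmin d e) by (apply Rmin_glb_lt; [lra|apply e]).
  pose proof (Rmin_l d e); pose proof (Rmin_r d e).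
  assert (h0 : 0 < h) by (unfold h; lra).
  assert (K : Rabs ((g (x + - h) - g x) / - h - l) < - l).
  { apply He; [lra|]. rewrite Rabs_Ropp, Rabs_pos_eq; unfold h; lra. }
  apply Rabs_def2 in K.
  assert (K2 : g (x + - h) <= g x) by (apply H; unfold h in *; lra).
  assert (E : g (x + - h) - g x = - h * ((g (x + - h) - g x) / - h)) by (field; lra).
  nra.
Qed.

Lemma is_derive_local_max (g : R -> R) (x l d : R) :
  is_derive g x l -> 0 < d -> (forall y, x - d < y < x + d -> g y <= g x) -> l = 0.
Proof.
  intros Hg Hd H.
  assert (0 <= l) by (apply (is_derive_left_max g x l d); auto; intros; apply H; lra).
  assert (0 <= - l).
  { apply (is_derive_left_max (fun y => g (- y)) (- x) (- l) d); auto.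
    - replace (- l) with (scal (-1) l) by (unfold scal; cbn; unfold mult; cbn; ring).
      apply (is_derive_comp g (fun y => - y)).
      + rewrite Ropp_involutive; exact Hg.
      + auto_derive; auto.
    - intros y Hy; rewrite Ropp_involutive; apply H; lra. }
  lra.
Qed.

(** If [g2 > 0], then [g1], which vanishes at [x], is positive just to the right of [x], and the
    mean value theorem makes [g] exceed [g x] there. *)
Lemma is_derive_2_local_max (g g1 : R -> R) (x g2 d : R) :
  0 < d -> (forall y, x - d < y < x + d -> is_derive g y (g1 y)) ->
  is_derive g1 x g2 -> (forall y, x - d < y < x + d -> g y <= g x) -> g2 <= 0.
Proof.
  intros Hd Hg Hg1 H.
  assert (E : g1 x = 0).
  { apply (is_derive_local_max g x _ d); auto. apply Hg; lra. }
  destruct (Rle_lt_dec g2 0) as [|Hpos]; [assumption|exfalso].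
  apply is_derive_Reals in Hg1.
  destruct (Hg1 g2 Hpos) as [e He].
  set (h := Rmin d e / 2).
  assert (Hm : 0 < Rmin d e) by (apply Rmin_glb_lt; [lra|apply e]).
  pose proof (Rmin_l d e); pose proof (Rmin_r d e).
  assert (h0 : 0 < h) by (unfold h; lra).
  assert (hd : h < d) by (unfold h; lra).
  assert (hh : h < e) by (unfold h; lra).
  destruct (MVT_cor2 g g1 x (x + h)) as (c & Hc & Hxc); [lra| |].
  { intros y Hy; apply is_derive_Reals, Hg; lra. }
  assert (K : Rabs ((g1 (x + (c - x)) - g1 x) / (c - x) - g2) < g2).
  { apply He; [lra|]. rewrite Rabs_pos_eq; lra. }
  replace (x + (c - x)) with c in K by ring.
  rewrite E in K. apply Rabs_def2 in K.
  assert (K2 : g1 c = (c - x) * ((g1 c - 0) / (c - x))) by (field; lra).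
  assert (0 < g1 c) by nra.
  assert (g (x + h) <= g x) by (apply H; lra).
  nra.
Qed.

Lemma exp_nondecreasing (x y : R) : x <= y -> exp x <= exp y.
Proof.
  intros [H| ->]; [apply Rlt_le, exp_increasing, H|apply Rle_refl].
Qed.

Lemma differentiable_pt_lim_partial (F : R -> R -> R) (x y lx ly : R) :
  differentiable_pt_lim F x y lx ly ->
  is_derive (fun s => F s y) x lx /\ is_derive (fun s => F x s) y ly.
Proof.
  intros H; split; apply is_derive_Reals.
  - replace lx with (lx * 1 + ly * 0) by ring.
    apply (derivable_pt_lim_comp_2d F (fun s => s) (fun _ => y)); auto.
    + apply derivable_pt_lim_id.
    + apply derivable_pt_lim_const.
  - replace ly with (lx * 0 + ly * 1) by ring.
    apply (derivable_pt_lim_comp_2d F (fun _ => x) (fun s => s)); auto.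
    + apply derivable_pt_lim_const.
    + apply derivable_pt_lim_id.
Qed.

Lemma is_derive_eq (g : R -> R) (x l l' : R) :
  is_derive g x l -> l = l' -> is_derive g x l'.
Proof. intros H <-; exact H. Qed.

(** Differentiates expressions in opaque functions: each [is_derive] hypothesis becomes an
    [ex_derive] fact for the side conditions of [auto_derive] and a [Derive] equation for rewriting
    its answer. Nonzero denominators must be among the hypotheses. *)
Ltac derive_abstract :=
  cbv beta in *;
  repeat match goal with
  | H : is_derive ?g ?s ?l |- _ =>
      let D := fresh "D" in
      assert (D : Derive (fun x : R => g x) s = l) by exact (is_derive_unique _ _ _ H);
      let X := fresh "X" in
      assert (X : ex_derive (fun x : R => g x) s) by (exists l; exact H);
      clear H
  end;
  auto_derive;
  [ repeat split; simpl in *; assumption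
  | repeat match goal with D : Derive _ _ = _ |- _ => rewrite D; clear D end;
    field; assumption ].

(* [E1 + i E2], [X + i Y] and [p + i q] are [1/z], [f] and [P = z f' / f] along
   a curve with [z' = (l1 + i l2) z], and [p1 + i q1 = z P']. Then [A + i B] is
   [phi = 1/z - 1/f], [a + i b] is [psi = z phi' = P/f - 1/z], and [c + i d] is
   [z psi']. *)
Section Phi_along_curve.

Variables (E1 E2 X Y p q : R -> R) (l1 l2 s p1 q1 : R).
Hypothesis N0 : X s ^ 2 + Y s ^ 2 <> 0.
Hypothesis HE1 : is_derive E1 s (- (l1 * E1 s - l2 * E2 s)).
Hypothesis HE2 : is_derive E2 s (- (l1 * E2 s + l2 * E1 s)).
Hypothesis HX : is_derive X s
  (l1 * (p s * X s - q s * Y s) - l2 * (p s * Y s + q s * X s)).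
Hypothesis HY : is_derive Y s
  (l1 * (p s * Y s + q s * X s) + l2 * (p s * X s - q s * Y s)).
Hypothesis Hp : is_derive p s (l1 * p1 - l2 * q1).
Hypothesis Hq : is_derive q s (l1 * q1 + l2 * p1).

Let N s := X s ^ 2 + Y s ^ 2.
Let A s := E1 s - X s / N s.
Let B s := E2 s + Y s / N s.
Let a s := - E1 s + (p s * X s + q s * Y s) / N s.
Let b s := - E2 s + (q s * X s - p s * Y s) / N s.
Let c := E1 s + ((p1 - p s ^ 2 + q s ^ 2) * X s + (q1 - 2 * p s * q s) * Y s) / N s.
Let d := E2 s + ((q1 - 2 * p s * q s) * X s - (p1 - p s ^ 2 + q s ^ 2) * Y s) / N s.

(** With [l1] and [l2] symbolic, one computation gives both the radial derivatives, at [(1, 0)], and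
    the angular ones, at [(0, 1)]. *)
Lemma derive_phi_psi :
  is_derive A s (l1 * a s - l2 * b s) /\ is_derive B s (l1 * b s + l2 * a s) /\
  is_derive a s (l1 * c - l2 * d) /\ is_derive b s (l1 * d + l2 * c).
Proof.
  split; [|split; [|split]].
  - unfold A, a, b, N; clear Hp Hq; derive_abstract.
  - unfold B, a, b, N; clear Hp Hq; derive_abstract.
  - unfold c, d, a, N; derive_abstract.
  - unfold c, d, b, N; derive_abstract.
Qed.

End Phi_along_curve.

(** * Jack's lemma in logarithmic coordinates *)

(* The condition at a boundary maximum of [|phi|^2 + eps (t + exp t)]:
   [psi / phi] is real and at least [- eps / |phi|^2]. *)
Lemma jack_boundary (A B a b E1 E2 e : R) :
  0 < e ->
  4 * e <= A ^ 2 + B ^ 2 - (E1 ^ 2 + E2 ^ 2) ->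
  A * b - B * a = 0 ->
  - e <= A * a + B * b ->
  - ((E1 - A) ^ 2 + (E2 - B) ^ 2)
    < 2 * ((A + a) * (E1 - A) + (B + b) * (E2 - B)) -> False.
Proof.
  intros He HF Ht Hn HP.
  set (F := A ^ 2 + B ^ 2) in *. set (rho := E1 ^ 2 + E2 ^ 2) in *.
  set (x := A * E1 + B * E2). set (j := A * a + B * b) in *.
  assert (rho0 : 0 <= rho) by (unfold rho; nra).
  assert (F0 : 0 < F) by lra.
  assert (Hx2 : x ^ 2 <= F * rho).
  { assert (F * rho - x ^ 2 = (A * E2 - B * E1) ^ 2) by (unfold F, rho, x; ring).
    pose proof (pow2_ge_0 (A * E2 - B * E1)); lra. }
  assert (Hx : - F <= x <= F) by (split; nra).
  (* By [Ht] the vector [(a, b)] is [j / F] times [(A, B)], so the inner product is [1 + j / F]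
     times [x - F]. *)
  assert (HFP : F * ((A + a) * (E1 - A) + (B + b) * (E2 - B)) = (F + j) * (x - F)).
  { assert (F * ((A + a) * (E1 - A) + (B + b) * (E2 - B)) - (F + j) * (x - F)
      = (A * b - B * a) * (A * E2 - B * E1)) by (unfold F, j, x; ring).
    rewrite Ht in H; lra. }
  assert (HS : (E1 - A) ^ 2 + (E2 - B) ^ 2 = rho - 2 * x + F)
    by (unfold rho, x, F; ring).
  rewrite HS in HP.
  assert (K : F * (- (rho - 2 * x + F))
    < F * (2 * ((A + a) * (E1 - A) + (B + b) * (E2 - B))))
    by (apply Rmult_lt_compat_l; assumption).
  (* Since [x <= F] and [- e <= j], the product [(F + j) * (x - F)] is at most [(F - e) * (x - F)].
     So [K] gives [F * (F - rho) < 2 * e * (F - x)], which is at most [4 * e * F] because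
     [- F <= x]; this is where the constant 4 in [HF] comes from. *)
  nra.
Qed.

(* In the coordinates [z = exp (t + i th)], the holomorphic functions
   [phi = A + i B] and [psi = a + i b = z phi'] satisfy the Cauchy-Riemann
   equations below, with [c + i d = z psi']. *)
Section Jack.

Variables A B a b c d : R -> R -> R.
Let E1 t th := exp (- t) * cos th.
Let E2 t th := - exp (- t) * sin th.

Hypothesis A_t : forall t th, t < 0 -> is_derive (fun s => A s th) t (a t th).
Hypothesis B_t : forall t th, t < 0 -> is_derive (fun s => B s th) t (b t th).
Hypothesis a_t : forall t th, t < 0 -> is_derive (fun s => a s th) t (c t th).
Hypothesis b_t : forall t th, t < 0 -> is_derive (fun s => b s th) t (d t th).
Hypothesis A_th : forall t th, t < 0 -> is_derive (A t) th (- b t th).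
Hypothesis B_th : forall t th, t < 0 -> is_derive (B t) th (a t th).
Hypothesis a_th : forall t th, t < 0 -> is_derive (a t) th (- d t th).
Hypothesis b_th : forall t th, t < 0 -> is_derive (b t) th (c t th).
Hypothesis A_cont : forall t th, t < 0 -> continuity_2d_pt A t th.
Hypothesis B_cont : forall t th, t < 0 -> continuity_2d_pt B t th.
Hypothesis A_per : forall t th, A t (th + 2 * PI) = A t th.
Hypothesis B_per : forall t th, B t (th + 2 * PI) = B t th.
(** The puncture [z = 0] lies at [t] equal to minus infinity. With [phi] bounded there, a barrier
    term [eps * t] dominates. *)
Hypothesis AB_bounded : exists M T, forall t th, t <= T -> A t th ^ 2 + B t th ^ 2 <= M.
(* [Re ((phi + psi) / (1/z - phi)) > - 1/2], where [E1 + i E2 = 1/z]. *)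
Hypothesis boundary : forall t th, t < 0 ->
  - ((E1 t th - A t th) ^ 2 + (E2 t th - B t th) ^ 2)
    < 2 * ((A t th + a t th) * (E1 t th - A t th)
           + (B t th + b t th) * (E2 t th - B t th)).

Section Barrier.

Variable eps : R.
Hypothesis eps0 : 0 < eps.

(* The term in [eps] makes the Laplacian of [u] positive, which excludes an
   interior maximum, and makes [u] tend to minus infinity at [z = 0]. *)
Let u t th := A t th ^ 2 + B t th ^ 2 + eps * (t + exp t).

Let u_t t th : t < 0 -> is_derive (fun s => u s th) t
  (2 * (A t th * a t th + B t th * b t th) + eps * (1 + exp t)).
Proof.
  intros Ht; pose proof (A_t t th Ht); pose proof (B_t t th Ht).
  unfold u; derive_abstract.
Qed.

Let u_th t th : t < 0 -> is_derive (u t) th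
  (2 * (B t th * a t th - A t th * b t th)).
Proof.
  intros Ht; pose proof (A_th t th Ht); pose proof (B_th t th Ht).
  unfold u; derive_abstract.
Qed.

Let u_tt t th : t < 0 -> is_derive
  (fun s => 2 * (A s th * a s th + B s th * b s th) + eps * (1 + exp s)) t
  (2 * (a t th ^ 2 + b t th ^ 2 + A t th * c t th + B t th * d t th) + eps * exp t).
Proof.
  intros Ht; pose proof (A_t t th Ht); pose proof (B_t t th Ht);
    pose proof (a_t t th Ht); pose proof (b_t t th Ht).
  derive_abstract.
Qed.

Let u_thth t th : t < 0 -> is_derive
  (fun s => 2 * (B t s * a t s - A t s * b t s)) th
  (2 * (a t th ^ 2 + b t th ^ 2 - A t th * c t th - B t th * d t th)).
Proof.
  intros Ht; pose proof (A_th t th Ht); pose proof (B_th t th Ht);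
    pose proof (a_th t th Ht); pose proof (b_th t th Ht).
  derive_abstract.
Qed.

Let u_cont t th : t < 0 -> continuity_2d_pt u t th.
Proof.
  intros Ht; unfold u.
  apply continuity_2d_pt_plus; [apply continuity_2d_pt_plus|].
  - apply (continuity_1d_2d_pt_comp (fun x => x ^ 2)); [reg|auto].
  - apply (continuity_1d_2d_pt_comp (fun x => x ^ 2)); [reg|auto].
  - apply (continuity_1d_2d_pt_comp (fun x => eps * (x + exp x)) (fun t _ => t)).
    + reg.
    + apply continuity_2d_pt_id1.
Qed.

Let u_per t th : u t (th + 2 * PI) = u t th.
Proof. unfold u; rewrite A_per, B_per; reflexivity. Qed.

(** Periodicity removes the angular edges: an angle within 1 of [th1] that leaves [[- PI, PI]]
    returns to it after a shift by [2 * PI]. The maximum is thus two-sided in [th]. *)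
Let u_max (T0 T1 ts ths : R) : T1 < 0 -> T0 <= ts <= T1 -> - PI <= ths <= PI ->
  exists t1 th1, T0 <= t1 <= T1 /\ u ts ths <= u t1 th1 /\
    forall t th, T0 <= t <= T1 -> th1 - 1 < th < th1 + 1 -> u t th <= u t1 th1.
Proof.
  intros HT Hts Hths.
  pose proof PI2_1 as Hpi; unfold PI2 in Hpi.
  destruct (continuous_2d_max u T0 T1 (- PI) PI) as (t1 & th1 & Ht1 & Hth1 & H).
  - lra.
  - lra.
  - intros t th Ht _; apply u_cont; lra.
  - exists t1, th1; split; [assumption|split; [auto|]].
    intros t th Ht Hth.
    destruct (Rlt_le_dec th (- PI)) as [Hl|Hl].
    { rewrite <- u_per; apply H; lra. }
    destruct (Rlt_le_dec PI th) as [Hr|Hr].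
    { replace th with (th - 2 * PI + 2 * PI) by ring.
      rewrite u_per; apply H; lra. }
    apply H; lra.
Qed.

Let no_max (T0 T1 t1 th1 : R) :
  T1 < 0 -> T0 < t1 <= T1 ->
  4 * eps <= A t1 th1 ^ 2 + B t1 th1 ^ 2 - exp (- T1) ^ 2 ->
  (forall t th, T0 <= t <= T1 -> th1 - 1 < th < th1 + 1 -> u t th <= u t1 th1) ->
  False.
Proof.
  intros HT Ht1 Hbig Hmax.
  assert (ut1 := u_t t1 th1 ltac:(lra)).
  assert (Hth := is_derive_local_max _ _ _ 1 (u_th t1 th1 ltac:(lra)) Rlt_0_1
    ltac:(intros; apply Hmax; lra)).
  destruct (Rlt_le_dec t1 T1) as [Hint|Hb].
  (* Interior maximum: both second derivatives are at most 0. In their sum [A * c + B * d] cancels,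
     leaving [4 * (a ^ 2 + b ^ 2) + eps * exp t1 <= 0], which is impossible. *)
  - assert (K1 := is_derive_2_local_max (u t1)
      (fun s => 2 * (B t1 s * a t1 s - A t1 s * b t1 s)) th1 _ 1 Rlt_0_1
      ltac:(intros; apply u_th; lra) (u_thth t1 th1 ltac:(lra))
      ltac:(intros; apply Hmax; lra)).
    set (dl := Rmin (t1 - T0) (T1 - t1)).
    assert (dl0 : 0 < dl) by (apply Rmin_glb_lt; lra).
    assert (dl1 : dl <= t1 - T0) by apply Rmin_l.
    assert (dl2 : dl <= T1 - t1) by apply Rmin_r.
    assert (K2 := is_derive_2_local_max (fun s => u s th1)
      (fun s => 2 * (A s th1 * a s th1 + B s th1 * b s th1) + eps * (1 + exp s))
      t1 _ dl dl0 ltac:(intros; apply u_t; lra) (u_tt t1 th1 ltac:(lra))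
      ltac:(intros; apply Hmax; lra)).
    pose proof (Rmult_lt_0_compat _ _ eps0 (exp_pos t1)).
    pose proof (pow2_ge_0 (a t1 th1)); pose proof (pow2_ge_0 (b t1 th1)).
    lra.
  - assert (t1 = T1) as -> by lra.
    (* Maximum on the outer edge: the angular derivative vanishes, so [A * b = B * a], and the
       radial one is nonnegative. As [exp T1 < 1], the latter gives [- eps <= A * a + B * b], as
       [jack_boundary] requires. *)
    assert (Ht := is_derive_left_max _ _ _ (T1 - T0) ut1 ltac:(lra)
      ltac:(intros; apply Hmax; lra)); cbv beta in Ht.
    apply (jack_boundary (A T1 th1) (B T1 th1) (a T1 th1) (b T1 th1)
      (E1 T1 th1) (E2 T1 th1) eps); auto.
    + replace (E1 T1 th1 ^ 2 + E2 T1 th1 ^ 2) with (exp (- T1) ^ 2); [assumption|].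
      pose proof (sin2_cos2 th1) as Hsc; unfold Rsqr in Hsc.
      unfold E1, E2.
      replace ((exp (- T1) * cos th1) ^ 2 + (- exp (- T1) * sin th1) ^ 2)
        with (exp (- T1) ^ 2 * (sin th1 * sin th1 + cos th1 * cos th1)) by ring.
      rewrite Hsc; ring.
    + lra.
    + assert (exp T1 < 1) by (rewrite <- exp_0; apply exp_increasing; assumption).
      nra.
Qed.

(** The last hypothesis keeps the maximum off the inner edge [t = T0]. Monotonicity of [t + exp t]
    carries the size condition from [(ts, ths)] to the unknown maximum point. *)
Let barrier (T0 T1 ts ths : R) :
  T1 < 0 -> T0 < ts <= T1 -> - PI <= ths <= PI ->
  4 * eps <= u ts ths - eps * (T1 + exp T1) - exp (- T1) ^ 2 ->
  (forall th, u T0 th < u ts ths) -> False.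
Proof.
  intros HT1 Hts Hths Hbig Hlow.
  destruct (u_max T0 T1 ts ths) as (t1 & th1 & Ht1 & Hle & Hmax); auto; [lra|].
  apply (no_max T0 T1 t1 th1); auto.
  - destruct (Rle_lt_or_eq_dec T0 t1) as [|E]; [lra|lra|].
    subst t1; specialize (Hlow th1); lra.
  - assert (Hexp : exp t1 <= exp T1) by (apply exp_nondecreasing; lra).
    assert (eps * (t1 + exp t1) <= eps * (T1 + exp T1))
      by (apply Rmult_le_compat_l; lra).
    unfold u in *; lra.
Qed.

Lemma jack_barrier (T0 T1 ts ths : R) :
  T1 < 0 -> T0 < ts <= T1 -> - PI <= ths <= PI ->
  4 * eps <= A ts ths ^ 2 + B ts ths ^ 2 - exp (- T1) ^ 2
    - eps * (T1 + exp T1 - ts - exp ts) ->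
  (forall th, A T0 th ^ 2 + B T0 th ^ 2 + eps * (T0 + exp T0)
    < A ts ths ^ 2 + B ts ths ^ 2 + eps * (ts + exp ts)) -> False.
Proof.
  intros HT1 Hts Hths Hbig Hlow.
  apply (barrier T0 T1 ts ths); auto; unfold u; lra.
Qed.

End Barrier.

Lemma jack_schwarz (ts ths : R) : ts < 0 -> - PI <= ths <= PI ->
  A ts ths ^ 2 + B ts ths ^ 2 <= 1.
Proof.
  intros Hts Hths.
  destruct (Rle_lt_dec (A ts ths ^ 2 + B ts ths ^ 2) 1) as [|HF]; [assumption|exfalso].
  set (F := A ts ths ^ 2 + B ts ths ^ 2) in *.
  destruct AB_bounded as (M & T & HM).
  set (L := ln F).
  assert (L0 : 0 < L) by (rewrite <- ln_1; apply ln_increasing; lra).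
  assert (HT1 : exists T1, T1 < 0 /\ ts <= T1 /\ exp (- T1) ^ 2 < F).
  (* From [- L / 4 <= T1] follows [exp (- T1) ^ 2 <= exp (L / 2)], the square root of [F], which is
     below [F] because [F > 1]. The entry [ts / 2] puts [T1] to the right of [ts]. *)
  { exists (Rmax (ts / 2) (- L / 4)).
    pose proof (Rmax_l (ts / 2) (- L / 4)); pose proof (Rmax_r (ts / 2) (- L / 4)).
    split; [apply Rmax_lub_lt; lra|split; [lra|]].
    replace (exp (- Rmax (ts / 2) (- L / 4)) ^ 2)
      with (exp (- Rmax (ts / 2) (- L / 4) + - Rmax (ts / 2) (- L / 4)))
      by (rewrite exp_plus; ring).
    rewrite <- (exp_ln F) by lra; apply exp_increasing; fold L; lra. }
  destruct HT1 as (T1 & HT10 & HtT & HFT).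
  (* The gap [F - exp (- T1) ^ 2] has to cover [4 * eps] and the barrier variation
     [eps * (T1 + exp T1 - ts - exp ts)], which is at most [eps * (1 - ts)]; hence the divisor
     [5 - ts]. *)
  set (eps := (F - exp (- T1) ^ 2) / (5 - ts)).
  assert (eps0 : 0 < eps) by (apply Rdiv_lt_0_compat; lra).
  assert (Heps : eps * (5 - ts) = F - exp (- T1) ^ 2) by (unfold eps; field; lra).
  set (us := F + eps * (ts + exp ts)).
  (* Three demands: the bound [M] applies at [T0], [T0] lies left of [ts], and
     [M + eps * (T0 + exp T0)] is below [us]. The 2 leaves room for [exp T0 < 1]. *)
  set (T0 := Rmin (Rmin T (ts - 1)) ((us - M) / eps - 2)).
  assert (T0 <= T /\ T0 <= ts - 1 /\ T0 <= (us - M) / eps - 2) as (HT0a & HT0b & HT0c).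
  { unfold T0.
    pose proof (Rmin_l (Rmin T (ts - 1)) ((us - M) / eps - 2)).
    pose proof (Rmin_r (Rmin T (ts - 1)) ((us - M) / eps - 2)).
    pose proof (Rmin_l T (ts - 1)); pose proof (Rmin_r T (ts - 1)). lra. }
  assert (exp1 : forall t, t < 0 -> exp t < 1)
    by (intros t Ht; rewrite <- exp_0; apply exp_increasing; assumption).
  apply (jack_barrier eps eps0 T0 T1 ts ths); auto; try lra; fold F.
  - pose proof (exp1 T1 HT10); pose proof (exp_pos ts).
    assert (eps * (T1 + exp T1 - ts - exp ts) <= eps * (1 - ts))
      by (apply Rmult_le_compat_l; lra).
    lra.
  - intros th; fold us.
    pose proof (HM T0 th HT0a); pose proof (exp1 T0 ltac:(lra)).
    assert (eps * (T0 + exp T0) < eps * ((us - M) / eps))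
      by (apply Rmult_lt_compat_l; lra).
    assert (eps * ((us - M) / eps) = us - M) by (field; lra).
    lra.
Qed.

End Jack.

(** * Polar coordinates *)

Lemma differentiable_pt_lim_snd (g : R -> R) (x y l : R) :
  derivable_pt_lim g y l -> differentiable_pt_lim (fun _ v => g v) x y 0 l.
Proof.
  intros Hg.
  assert (Hid : differentiable_pt_lim (fun _ v : R => v) x y 0 1).
  { intros eps; exists eps; intros u v _ _.
    replace (v - y - (0 * (u - x) + 1 * (v - y))) with 0 by ring.
    rewrite Rabs_R0; apply Rmult_le_pos; [apply Rlt_le, eps|].
    eapply Rle_trans; [apply Rabs_pos|apply Rmax_l]. }
  replace 0 with (l * 0 + 0 * 0) by ring.
  replace l with (l * 1 + 0 * 1) at 2 by ring.
  apply (differentiable_pt_lim_comp (fun u _ => g u) (fun _ v => v) (fun _ v => v));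
    auto.
  apply differentiable_pt_lim_proj1_0, Hg.
Qed.

Lemma differentiable_pt_lim_mult_sep (g h : R -> R) (x y g1 h1 : R) :
  derivable_pt_lim g x g1 -> derivable_pt_lim h y h1 ->
  differentiable_pt_lim (fun u v => g u * h v) x y (g1 * h y) (g x * h1).
Proof.
  intros Hg Hh.
  assert (Hmul : forall a b, differentiable_pt_lim Rmult a b b a).
  { intros a b eps; exists eps; intros u v Hu Hv.
    replace (u * v - a * b - (b * (u - a) + a * (v - b)))
      with ((u - a) * (v - b)) by ring.
    rewrite Rabs_mult; apply Rmult_le_compat; try apply Rabs_pos; [lra|].
    apply Rmax_r. }
  replace (g1 * h y) with (h y * g1 + g x * 0) by ring.
  replace (g x * h1) with (h y * 0 + g x * h1) by ring.
  apply (differentiable_pt_lim_comp Rmult (fun u _ => g u) (fun _ v => h v)); auto.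
  - apply differentiable_pt_lim_proj1_0, Hg.
  - apply differentiable_pt_lim_snd, Hh.
Qed.

Definition polar (t th : R) : C := (exp t * cos th, exp t * sin th).

Lemma Cmod_polar (t th : R) : Cmod (polar t th) = exp t.
Proof.
  unfold Cmod, polar; cbn [fst snd].
  pose proof (sin2_cos2 th) as H; unfold Rsqr in H.
  replace ((exp t * cos th) ^ 2 + (exp t * sin th) ^ 2)
    with (exp t * exp t * (sin th * sin th + cos th * cos th)) by ring.
  rewrite H, Rmult_1_r; apply sqrt_square, Rlt_le, exp_pos.
Qed.

Lemma polar_in_disc (t th : R) : t < 0 -> in_disc (polar t th).
Proof.
  intros Ht; unfold in_disc; rewrite Cmod_polar, <- exp_0.
  apply exp_increasing, Ht.
Qed.

Lemma polar_neq_0 (t th : R) : polar t th <> 0.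
Proof.
  intros H; pose proof (exp_pos t).
  rewrite <- (Cmod_polar t th), H, Cmod_0 in *; lra.
Qed.

Lemma polar_per (t th : R) : polar t (th + 2 * PI) = polar t th.
Proof.
  unfold polar. replace (th + 2 * PI) with (th + 2 * INR 1 * PI) by (simpl; ring).
  rewrite cos_period, sin_period; reflexivity.
Qed.

Lemma polar_surj (z : C) : z <> 0 ->
  exists t th, - PI <= th <= PI /\ z = polar t th.
Proof.
  intros Hz; apply Cmod_gt_0 in Hz.
  set (r := Cmod z) in *.
  destruct z as [x y].
  assert (Hr : r ^ 2 = x ^ 2 + y ^ 2).
  { unfold r, Cmod; cbn [fst snd]; rewrite pow2_sqrt; nra. }
  assert (Hx : -1 <= x / r <= 1).
  { assert (- r <= x <= r) by (split; nra).
    split; apply (Rmult_le_reg_r r); auto; unfold Rdiv;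
      rewrite Rmult_assoc, Rinv_l; lra. }
  pose proof (acos_bound (x / r)).
  assert (Hs : r * sin (acos (x / r)) = Rabs y).
  { rewrite sin_acos by auto.
    rewrite <- (sqrt_square r) at 1 by lra.
    assert (0 <= 1 - Rsqr (x / r)) by (unfold Rsqr; nra).
    rewrite <- sqrt_mult by nra.
    replace (r * r * (1 - Rsqr (x / r))) with (Rsqr y).
    - apply sqrt_Rsqr_abs.
    - unfold Rsqr; field_simplify; nra. }
  exists (ln r).
  destruct (Rle_lt_dec 0 y) as [Hy|Hy].
  - exists (acos (x / r)); split; [lra|].
    unfold polar; rewrite exp_ln, Hs, cos_acos, Rabs_pos_eq by auto.
    f_equal; field; lra.
  - exists (- acos (x / r)); split; [lra|].
    unfold polar; rewrite cos_neg, sin_neg, exp_ln, cos_acos by auto.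
    rewrite Ropp_mult_distr_r_reverse, Hs, Rabs_left by auto.
    f_equal; [field; lra|ring].
Qed.

(** Chain rule for [z = exp (t + i th)]: the partials of [z] are [z] in [t] and [i z] in [th], so
    those of [F] are [z F'] and [i z F']. *)
Lemma differentiable_polar (F : C -> C) (t th : R) (l : C) :
  Cis_derive F (polar t th) l ->
  differentiable_pt_lim (fun t th => Re (F (polar t th))) t th
    (Re (polar t th * l)%C) (- Im (polar t th * l)%C) /\
  differentiable_pt_lim (fun t th => Im (F (polar t th))) t th
    (Im (polar t th * l)%C) (Re (polar t th * l)%C).
Proof.
  intros H; destruct (Cis_derive_differentiable F _ _ l H) as [H1 H2].
  assert (Hc := differentiable_pt_lim_mult_sep exp cos t th _ _
    (derivable_pt_lim_exp t) (derivable_pt_lim_cos th)).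
  assert (Hs := differentiable_pt_lim_mult_sep exp sin t th _ _
    (derivable_pt_lim_exp t) (derivable_pt_lim_sin th)).
  assert (K1 := differentiable_pt_lim_comp _ _ _ t th _ _ _ _ _ _ H1 Hc Hs).
  assert (K2 := differentiable_pt_lim_comp _ _ _ t th _ _ _ _ _ _ H2 Hc Hs).
  cbv beta in K1, K2.
  split.
  - match type of K1 with differentiable_pt_lim _ _ _ ?lx ?ly =>
      replace (Re (polar t th * l)%C) with lx
        by (destruct l; unfold polar; cbn; ring);
      replace (- Im (polar t th * l)%C) with ly
        by (destruct l; unfold polar; cbn; ring) end.
    exact K1.
  - match type of K2 with differentiable_pt_lim _ _ _ ?lx ?ly =>
      replace (Im (polar t th * l)%C) with lx
        by (destruct l; unfold polar; cbn; ring);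
      replace (Re (polar t th * l)%C) with ly
        by (destruct l; unfold polar; cbn; ring) end.
    exact K2.
Qed.

(** This integrates the bound on [g1] from minus infinity: [g + c * exp] is nondecreasing and
    [g - c * exp] nonincreasing. Far to the left the former is at least [- eta] and the latter at
    most [eta]. *)
Lemma decay_at_minus_infinity (g g1 : R -> R) (T c : R) :
  (forall t, t <= T -> is_derive g t (g1 t)) ->
  (forall t, t <= T -> Rabs (g1 t) <= c * exp t) ->
  (forall eta, 0 < eta -> exists t0, forall t, t <= t0 -> Rabs (g t) <= eta) ->
  forall t, t <= T -> Rabs (g t) <= c * exp t.
Proof.
  intros Hg Hg1 Hlim t Ht.
  assert (c0 : 0 <= c).
  { pose proof (Rle_trans _ _ _ (Rabs_pos _) (Hg1 t Ht)); pose proof (exp_pos t); nra. }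
  apply le_epsilon; intros eta Heta.
  destruct (Hlim eta Heta) as [t0 Ht0].
  set (tau := Rmin t0 (t - 1)).
  assert (tau <= t0) by apply Rmin_l.
  assert (tau <= t - 1) by apply Rmin_r.
  assert (B0 := Ht0 tau ltac:(assumption)); apply Rabs_le_between in B0.
  pose proof (Rmult_le_pos _ _ c0 (Rlt_le _ _ (exp_pos tau))).
  apply Rabs_le; split.
  - destruct (MVT_cor2 (fun s => g s + c * exp s) (fun s => g1 s + c * exp s) tau t)
      as (x & Hx & Hx2); [lra| |].
    { intros s Hs; apply is_derive_Reals.
      pose proof (Hg s ltac:(lra)); derive_abstract. }
    assert (K := Hg1 x ltac:(lra)); apply Rabs_le_between in K.
    nra.
  - destruct (MVT_cor2 (fun s => g s - c * exp s) (fun s => g1 s - c * exp s) tau t)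
      as (x & Hx & Hx2); [lra| |].
    { intros s Hs; apply is_derive_Reals.
      pose proof (Hg s ltac:(lra)); derive_abstract. }
    assert (K := Hg1 x ltac:(lra)); apply Rabs_le_between in K.
    nra.
Qed.

(** * Starlike functions of order 1/2 *)

Section Starlike_order_half.

Variables f f' P P' : C -> C.
Hypothesis f_derive : forall z, in_disc z -> Cis_derive f z (f' z).
Hypothesis P_derive : forall z, in_disc z -> Cis_derive P z (P' z).
Hypothesis f_0 : f 0 = 0.
Hypothesis f'_0 : f' 0 = 1.
Hypothesis P_0 : P 0 = 1.
Hypothesis f_neq_0 : forall z, in_disc z -> z <> 0 -> f z <> 0.
Hypothesis zf' : forall z, in_disc z -> z <> 0 -> (z * f' z = P z * f z)%C.
Hypothesis P_half : forall z, in_disc z -> / 2 < Re (P z).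

Let X t th := Re (f (polar t th)).
Let Y t th := Im (f (polar t th)).
Let p t th := Re (P (polar t th)).
Let q t th := Im (P (polar t th)).
Let p1 t th := Re (polar t th * P' (polar t th))%C.
Let q1 t th := Im (polar t th * P' (polar t th))%C.
Let N t th := X t th ^ 2 + Y t th ^ 2.
Let E1 t th := exp (- t) * cos th.
Let E2 t th := - exp (- t) * sin th.
Let A t th := E1 t th - X t th / N t th.
Let B t th := E2 t th + Y t th / N t th.
Let a t th := - E1 t th + (p t th * X t th + q t th * Y t th) / N t th.
Let b t th := - E2 t th + (q t th * X t th - p t th * Y t th) / N t th.
Let c t th := E1 t th + ((p1 t th - p t th ^ 2 + q t th ^ 2) * X t th
  + (q1 t th - 2 * p t th * q t th) * Y t th) / N t th.
Let d t th := E2 t th + ((q1 t th - 2 * p t th * q t th) * X t th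
  - (p1 t th - p t th ^ 2 + q t th ^ 2) * Y t th) / N t th.

Let N_pos t th : t < 0 -> 0 < N t th.
Proof.
  intros Ht; apply Rnot_le_lt; intros H.
  apply (f_neq_0 (polar t th) (polar_in_disc t th Ht) (polar_neq_0 t th)).
  unfold N, X, Y in H; destruct (f (polar t th)) as [x y]; cbn [Re Im fst snd] in H.
  apply injective_projections; cbn; nra.
Qed.

Let N_neq_0 t th : t < 0 -> X t th ^ 2 + Y t th ^ 2 <> 0.
Proof. intros Ht; apply Rgt_not_eq, N_pos, Ht. Qed.

Let X_diff t th : t < 0 -> differentiable_pt_lim X t th
  (p t th * X t th - q t th * Y t th) (- (p t th * Y t th + q t th * X t th)).
Proof.
  intros Ht.
  assert (K := proj1 (differentiable_polar f t th _ (f_derive _ (polar_in_disc t th Ht)))).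
  rewrite zf' in K by (apply polar_in_disc, Ht || apply polar_neq_0); exact K.
Qed.

Let Y_diff t th : t < 0 -> differentiable_pt_lim Y t th
  (p t th * Y t th + q t th * X t th) (p t th * X t th - q t th * Y t th).
Proof.
  intros Ht.
  assert (K := proj2 (differentiable_polar f t th _ (f_derive _ (polar_in_disc t th Ht)))).
  rewrite zf' in K by (apply polar_in_disc, Ht || apply polar_neq_0); exact K.
Qed.

Let p_diff t th : t < 0 -> differentiable_pt_lim p t th (p1 t th) (- q1 t th).
Proof. intros Ht; apply differentiable_polar, P_derive, polar_in_disc, Ht. Qed.

Let q_diff t th : t < 0 -> differentiable_pt_lim q t th (q1 t th) (p1 t th).
Proof. intros Ht; apply differentiable_polar, P_derive, polar_in_disc, Ht. Qed.

Let t_derive t th : t < 0 ->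
  is_derive (fun s => A s th) t (a t th) /\
  is_derive (fun s => B s th) t (b t th) /\
  is_derive (fun s => a s th) t (c t th) /\
  is_derive (fun s => b s th) t (d t th).
Proof.
  intros Ht.
  assert (HE1 : is_derive (fun s => E1 s th) t (- (1 * E1 t th - 0 * E2 t th)))
    by (unfold E1; auto_derive; [auto|ring]).
  assert (HE2 : is_derive (fun s => E2 s th) t (- (1 * E2 t th + 0 * E1 t th)))
    by (unfold E2; auto_derive; [auto|ring]).
  destruct (differentiable_pt_lim_partial _ _ _ _ _ (X_diff t th Ht)) as [HX _].
  destruct (differentiable_pt_lim_partial _ _ _ _ _ (Y_diff t th Ht)) as [HY _].
  destruct (differentiable_pt_lim_partial _ _ _ _ _ (p_diff t th Ht)) as [Hp _].
  destruct (differentiable_pt_lim_partial _ _ _ _ _ (q_diff t th Ht)) as [Hq _].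
  destruct (derive_phi_psi (fun s => E1 s th) (fun s => E2 s th) (fun s => X s th)
    (fun s => Y s th) (fun s => p s th) (fun s => q s th) 1 0 t (p1 t th) (q1 t th)
    (N_neq_0 t th Ht)) as (KA & KB & Ka & Kb);
    try (eapply is_derive_eq; [eassumption|cbv beta; ring]).
  split; [|split; [|split]];
    [ eapply is_derive_eq; [exact KA|] | eapply is_derive_eq; [exact KB|]
    | eapply is_derive_eq; [exact Ka|] | eapply is_derive_eq; [exact Kb|] ];
    unfold a, b, c, d, N; ring.
Qed.

Let th_derive t th : t < 0 ->
  is_derive (A t) th (- b t th) /\
  is_derive (B t) th (a t th) /\
  is_derive (a t) th (- d t th) /\
  is_derive (b t) th (c t th).
Proof.
  intros Ht.
  assert (HE1 : is_derive (E1 t) th (- (0 * E1 t th - 1 * E2 t th)))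
    by (unfold E1; auto_derive; [auto|unfold E2; ring]).
  assert (HE2 : is_derive (E2 t) th (- (0 * E2 t th + 1 * E1 t th)))
    by (unfold E2; auto_derive; [auto|unfold E1; ring]).
  destruct (differentiable_pt_lim_partial _ _ _ _ _ (X_diff t th Ht)) as [_ HX].
  destruct (differentiable_pt_lim_partial _ _ _ _ _ (Y_diff t th Ht)) as [_ HY].
  destruct (differentiable_pt_lim_partial _ _ _ _ _ (p_diff t th Ht)) as [_ Hp].
  destruct (differentiable_pt_lim_partial _ _ _ _ _ (q_diff t th Ht)) as [_ Hq].
  destruct (derive_phi_psi (E1 t) (E2 t) (X t) (Y t) (p t) (q t) 0 1 th
    (p1 t th) (q1 t th) (N_neq_0 t th Ht)) as (KA & KB & Ka & Kb);
    try (eapply is_derive_eq; [eassumption|cbv beta; ring]).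
  split; [|split; [|split]];
    [ eapply is_derive_eq; [exact KA|] | eapply is_derive_eq; [exact KB|]
    | eapply is_derive_eq; [exact Ka|] | eapply is_derive_eq; [exact Kb|] ];
    unfold a, b, c, d, N; ring.
Qed.

Let X_cont t th : t < 0 -> continuity_2d_pt X t th.
Proof. intros Ht; eapply differentiable_continuity_pt; do 2 eexists; apply X_diff, Ht. Qed.

Let Y_cont t th : t < 0 -> continuity_2d_pt Y t th.
Proof. intros Ht; eapply differentiable_continuity_pt; do 2 eexists; apply Y_diff, Ht. Qed.

Let inv_N_cont t th : t < 0 -> continuity_2d_pt (fun t th => / N t th) t th.
Proof.
  intros Ht; apply continuity_2d_pt_inv; [|apply N_neq_0, Ht].
  apply continuity_2d_pt_plus.
  - apply (continuity_1d_2d_pt_comp (fun x => x ^ 2)); [reg|auto].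
  - apply (continuity_1d_2d_pt_comp (fun x => x ^ 2)); [reg|auto].
Qed.

Let exp_opp_derive t : derivable_pt_lim (fun t => exp (- t)) t (- exp (- t)).
Proof. apply is_derive_Reals; auto_derive; [auto|ring]. Qed.

Let A_cont t th : t < 0 -> continuity_2d_pt A t th.
Proof.
  intros Ht; apply continuity_2d_pt_minus; [|apply continuity_2d_pt_mult; auto].
  apply differentiable_continuity_pt; do 2 eexists.
  apply (differentiable_pt_lim_mult_sep (fun t => exp (- t)) cos).
  - apply exp_opp_derive.
  - apply derivable_pt_lim_cos.
Qed.

Let B_cont t th : t < 0 -> continuity_2d_pt B t th.
Proof.
  intros Ht; apply continuity_2d_pt_plus; [|apply continuity_2d_pt_mult; auto].
  apply differentiable_continuity_pt; do 2 eexists.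
  apply (differentiable_pt_lim_mult_sep (fun t => - exp (- t)) sin).
  - apply derivable_pt_lim_opp, exp_opp_derive.
  - apply derivable_pt_lim_sin.
Qed.

(** Here [1/z - phi = 1/f] and [phi + psi = (P - 1) / f], so the quotient is [P - 1], whose real
    part exceeds [- 1/2] by [P_half]. *)
Let boundary t th : t < 0 ->
  - ((E1 t th - A t th) ^ 2 + (E2 t th - B t th) ^ 2)
    < 2 * ((A t th + a t th) * (E1 t th - A t th)
           + (B t th + b t th) * (E2 t th - B t th)).
Proof.
  intros Ht.
  pose proof (N_pos t th Ht) as HN.
  assert (Hp : / 2 < p t th) by apply P_half, polar_in_disc, Ht.
  replace ((E1 t th - A t th) ^ 2 + (E2 t th - B t th) ^ 2) with (/ N t th)
    by (unfold A, B, N in *; field; lra).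
  replace ((A t th + a t th) * (E1 t th - A t th)
           + (B t th + b t th) * (E2 t th - B t th))
    with ((p t th - 1) / N t th) by (unfold A, B, a, b, N in *; field; lra).
  apply Rinv_0_lt_compat in HN; unfold Rdiv; nra.
Qed.

(* [1 - z phi = z / f] tends to 1 at 0 and its logarithmic derivative is
   [(1 - P) / z], which is bounded near 0; hence [z phi = O(z)]. *)
Let bounded : exists M T, forall t th, t <= T -> A t th ^ 2 + B t th ^ 2 <= M.
Proof.
  destruct (Cis_derive_eps P 0 (P' 0) (P_derive 0 ltac:(unfold in_disc; rewrite Cmod_0; lra))
    (mkposreal 1 Rlt_0_1)) as [dP HP]; cbn [pos] in HP.
  rewrite P_0 in HP.
  assert (f_lin : forall e, 0 < e -> exists t0, forall t th, t <= t0 ->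
    Cmod (f (polar t th) - polar t th)%C <= e * exp t).
  { intros e He.
    destruct (Cis_derive_eps f 0 (f' 0) (f_derive 0 ltac:(unfold in_disc; rewrite Cmod_0; lra))
      (mkposreal e He)) as [df Hf]; cbn [pos] in Hf.
    rewrite f_0, f'_0 in Hf.
    exists (ln (df / 2)); intros t th Ht.
    assert (df0 : 0 < df / 2) by (destruct df; cbn; lra).
    specialize (Hf (polar t th)).
    replace (polar t th - 0)%C with (polar t th) in Hf by ring.
    replace (f (polar t th) - 0 - 1 * polar t th)%C
      with (f (polar t th) - polar t th)%C in Hf by ring.
    rewrite Cmod_polar in Hf; apply Hf.
    eapply Rle_lt_trans; [apply exp_nondecreasing, Ht|rewrite exp_ln by assumption; lra]. }
  set (K := Cmod (P' 0) + 1).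
  assert (K0 : 0 < K) by (pose proof (Cmod_ge_0 (P' 0)); unfold K; lra).
  (* [G = z / f = 1 - z phi] satisfies [z G' = - (P - 1) G]. This is the derivative in [t]
     integrated in [D1] and [D2], for the real part [g1] and the imaginary part [g2] of [G]. *)
  set (G := fun t th => Cdiv (polar t th) (f (polar t th))).
  destruct (f_lin (/ 2) ltac:(lra)) as [T1 HT1].
  (* Closeness of [f] to [z] within [|z| / 2] forces [|f| >= |z| / 2], whence both factors 2. *)
  assert (G_near : forall e t th, 0 < e -> t < 0 ->
     Cmod (f (polar t th) - polar t th)%C <= / 2 * exp t ->
     Cmod (f (polar t th) - polar t th)%C <= e * exp t ->
     Cmod (G t th) <= 2 /\ Cmod (G t th - 1)%C <= 2 * e).
  { intros e t th He Ht H1 H2.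
    pose proof (f_neq_0 _ (polar_in_disc t th Ht) (polar_neq_0 t th)) as Hf.
    assert (Hf2 : / 2 * exp t <= Cmod (f (polar t th))).
    { assert (K1 := Cmod_triangle (f (polar t th)) (- (f (polar t th) - polar t th))%C).
      replace (f (polar t th) + - (f (polar t th) - polar t th))%C
        with (polar t th) in K1 by ring.
      rewrite Cmod_opp, Cmod_polar in K1; lra. }
    pose proof (exp_pos t).
    split.
    - unfold G; rewrite Cmod_div, Cmod_polar by assumption.
      apply Rle_div_l; lra.
    - replace (G t th - 1)%C with (- ((f (polar t th) - polar t th) / f (polar t th)))%C
        by (unfold G; field; assumption).
      rewrite Cmod_opp, Cmod_div by assumption.
      apply Rle_div_l; [lra|].
      assert (e * exp t <= 2 * e * Cmod (f (polar t th))) by nra.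
      lra. }
  set (T := Rmin (Rmin T1 (-1)) (ln (dP / 2))).
  assert (T <= T1 /\ T <= -1 /\ T <= ln (dP / 2)) as (HTa & HTb & HTc).
  { unfold T; pose proof (Rmin_l (Rmin T1 (-1)) (ln (dP / 2)));
    pose proof (Rmin_r (Rmin T1 (-1)) (ln (dP / 2)));
    pose proof (Rmin_l T1 (-1)); pose proof (Rmin_r T1 (-1)); lra. }
  assert (P_near : forall t th, t <= T -> Cmod (P (polar t th) - 1)%C <= K * exp t).
  { intros t th Ht.
    assert (dP0 : 0 < dP / 2) by (destruct dP; cbn; lra).
    specialize (HP (polar t th)).
    replace (polar t th - 0)%C with (polar t th) in HP by ring.
    rewrite Cmod_polar in HP.
    assert (K1 := Cmod_triangle (P (polar t th) - 1 - P' 0 * polar t th)%C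
       (P' 0 * polar t th)%C).
    replace (P (polar t th) - 1 - P' 0 * polar t th + P' 0 * polar t th)%C
      with (P (polar t th) - 1)%C in K1 by ring.
    rewrite Cmod_mult, Cmod_polar in K1.
    assert (exp t < dP).
    { eapply Rle_lt_trans; [apply exp_nondecreasing, Rle_trans with (1 := Ht), HTc|].
      rewrite exp_ln by assumption; lra. }
    specialize (HP ltac:(assumption)); unfold K; lra. }
  assert (G_bound : forall t th, t <= T ->
    Cmod ((P (polar t th) - 1) * G t th)%C <= 2 * K * exp t).
  { intros t th Ht; rewrite Cmod_mult.
    assert (Cmod (G t th) <= 2)
      by (apply (G_near (/ 2)); try apply HT1; lra).
    pose proof (P_near t th Ht).
    pose proof (Cmod_ge_0 (P (polar t th) - 1)%C).
    pose proof (Cmod_ge_0 (G t th)). nra. }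
  assert (G_lim : forall th e, 0 < e -> exists t0, forall t, t <= t0 ->
    Cmod (G t th - 1)%C <= e).
  { intros th e He; destruct (f_lin (e / 2) ltac:(lra)) as [t0 Ht0].
    exists (Rmin t0 T); intros t Ht.
    pose proof (Rmin_l t0 T); pose proof (Rmin_r t0 T).
    replace e with (2 * (e / 2)) by field.
    apply (G_near (e / 2)); try lra; [apply HT1|apply Ht0]; lra. }
  set (g1 := fun t th => exp t * (cos th * X t th + sin th * Y t th) / N t th).
  set (g2 := fun t th => exp t * (sin th * X t th - cos th * Y t th) / N t th).
  assert (HG : forall t th, t < 0 -> G t th = (g1 t th, g2 t th)).
  { intros t th Ht; pose proof (N_neq_0 t th Ht) as HN.
    unfold G, g1, g2, N, X, Y in *; destruct (f (polar t th)) as [x y].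
    cbn [Re Im fst snd] in *.
    apply injective_projections; cbn; field;
      contradict HN; rewrite <- HN; ring. }
  (* [D1] and [D2] bound each component of [G - 1 = - z phi] by [2 * K * |z|]; the sum of two such
     squares, divided by [|z| ^ 2], is [8 * K ^ 2]. *)
  exists (8 * K ^ 2), T; intros t th Ht.
  assert (D1 : forall s, s <= T -> Rabs (g1 s th - 1) <= 2 * K * exp s).
  { apply decay_at_minus_infinity with
      (g1 := fun s => - Re ((P (polar s th) - 1) * G s th)%C).
    - intros s Hs; rewrite HG by lra.
      destruct (differentiable_pt_lim_partial _ _ _ _ _ (X_diff s th ltac:(lra))) as [HX _].
      destruct (differentiable_pt_lim_partial _ _ _ _ _ (Y_diff s th ltac:(lra))) as [HY _].
      pose proof (N_neq_0 s th ltac:(lra)).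
      replace (- Re ((P (polar s th) - 1) * (g1 s th, g2 s th))%C)
        with (- ((p s th - 1) * g1 s th - q s th * g2 s th))
        by (unfold p, q; destruct (P (polar s th)); cbn; ring).
      unfold g1, g2, N in *; derive_abstract.
    - intros s Hs; rewrite Rabs_Ropp.
      eapply Rle_trans; [|apply (G_bound s th Hs)].
      eapply Rle_trans; [apply Rmax_l|apply Rmax_Cmod].
    - intros e He; destruct (G_lim th e He) as [t0 Ht0].
      exists (Rmin t0 T); intros s Hs.
      pose proof (Rmin_l t0 T); pose proof (Rmin_r t0 T).
      eapply Rle_trans; [|apply (Ht0 s); lra].
      rewrite HG by lra.
      eapply Rle_trans; [|apply Rmax_Cmod].
      eapply Rle_trans; [|apply Rmax_l]; apply Req_le; reflexivity. }
  assert (D2 : forall s, s <= T -> Rabs (g2 s th) <= 2 * K * exp s).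
  { apply decay_at_minus_infinity with
      (g1 := fun s => - Im ((P (polar s th) - 1) * G s th)%C).
    - intros s Hs; rewrite HG by lra.
      destruct (differentiable_pt_lim_partial _ _ _ _ _ (X_diff s th ltac:(lra))) as [HX _].
      destruct (differentiable_pt_lim_partial _ _ _ _ _ (Y_diff s th ltac:(lra))) as [HY _].
      pose proof (N_neq_0 s th ltac:(lra)).
      replace (- Im ((P (polar s th) - 1) * (g1 s th, g2 s th))%C)
        with (- ((p s th - 1) * g2 s th + q s th * g1 s th))
        by (unfold p, q; destruct (P (polar s th)); cbn; ring).
      unfold g1, g2, N in *; derive_abstract.
    - intros s Hs; rewrite Rabs_Ropp.
      eapply Rle_trans; [|apply (G_bound s th Hs)].
      eapply Rle_trans; [apply Rmax_r|apply Rmax_Cmod].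
    - intros e He; destruct (G_lim th e He) as [t0 Ht0].
      exists (Rmin t0 T); intros s Hs.
      pose proof (Rmin_l t0 T); pose proof (Rmin_r t0 T).
      eapply Rle_trans; [|apply (Ht0 s); lra].
      rewrite HG by lra.
      eapply Rle_trans; [|apply Rmax_Cmod].
      eapply Rle_trans; [|apply Rmax_r]; apply Req_le; f_equal; cbn; ring. }
  pose proof (exp_pos t).
  assert (HAB : exp t ^ 2 * (A t th ^ 2 + B t th ^ 2)
    = (g1 t th - 1) ^ 2 + g2 t th ^ 2).
  { pose proof (N_neq_0 t th ltac:(lra)).
    pose proof (sin2_cos2 th) as Hsc; unfold Rsqr in Hsc.
    assert (Hc : cos th ^ 2 = 1 - sin th ^ 2) by (rewrite <- Hsc; ring).
    unfold A, B, E1, E2, g1, g2, N; rewrite exp_Ropp.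
    field_simplify_eq; [|split; [assumption|lra]].
    ring [Hc]. }
  specialize (D1 t Ht); specialize (D2 t Ht).
  assert ((g1 t th - 1) ^ 2 <= (2 * K * exp t) ^ 2)
    by (rewrite <- (pow2_abs (g1 t th - 1)); apply pow_incr; split; [apply Rabs_pos|assumption]).
  assert (g2 t th ^ 2 <= (2 * K * exp t) ^ 2)
    by (rewrite <- (pow2_abs (g2 t th)); apply pow_incr; split; [apply Rabs_pos|assumption]).
  apply (Rmult_le_reg_l (exp t ^ 2)); [nra|]. lra.
Qed.

(** From [|phi| <= 1] comes [|1 - z/f| = |z phi| <= |z| < 1], that is, [f/z] is closer to 1 than to
    0. *)
Lemma Re_f_over_z_half z : in_disc z -> z <> 0 -> / 2 < Re (f z / z)%C.
Proof.
  intros Hz Hz0.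
  destruct (polar_surj z Hz0) as (t & th & Hth & ->).
  unfold in_disc in Hz; rewrite Cmod_polar, <- exp_0 in Hz.
  apply exp_lt_inv in Hz.
  assert (H : A t th ^ 2 + B t th ^ 2 <= 1).
  { apply (jack_schwarz A B a b c d); auto; intros; try apply t_derive; try apply th_derive;
      auto; unfold A, B, E1, E2, N, X, Y; rewrite polar_per;
      replace (th0 + 2 * PI) with (th0 + 2 * INR 1 * PI) by (simpl; ring);
      rewrite ?cos_period, ?sin_period; reflexivity. }
  pose proof (exp_pos t).
  assert (exp t < 1) by (rewrite <- exp_0; apply exp_increasing, Hz).
  pose proof (sin2_cos2 th) as Hsc; unfold Rsqr in Hsc.
  assert (Hc : cos th ^ 2 = 1 - sin th ^ 2) by (rewrite <- Hsc; ring).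
  pose proof (N_pos t th Hz) as HN; pose proof (N_neq_0 t th Hz).
  set (S := X t th * cos th + Y t th * sin th).
  assert (HS : Re (f (polar t th) / polar t th)%C = S / exp t).
  { unfold Cdiv, Cinv, S, X, Y; unfold polar at 2; cbn.
    replace (exp t * cos th * (exp t * cos th * 1) + exp t * sin th * (exp t * sin th * 1))
      with (exp t ^ 2) by (ring [Hc]).
    unfold Re, Im; field; apply Rgt_not_eq; assumption. }
  rewrite HS.
  (* This is [|f| ^ 2 * |z phi| ^ 2 = |f - z| ^ 2], with [exp t * S] the real inner product of [f]
     and [z]. *)
  assert (HAB : exp t ^ 2 * N t th * (A t th ^ 2 + B t th ^ 2)
    = N t th + exp t ^ 2 - 2 * exp t * S).
  { unfold A, B, E1, E2, S, N; rewrite exp_Ropp.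
    field_simplify_eq; [|split; [assumption|lra]].
    ring [Hc]. }
  assert (exp t ^ 2 * N t th * (A t th ^ 2 + B t th ^ 2) <= exp t ^ 2 * N t th * 1)
    by (apply Rmult_le_compat_l; nra).
  assert (exp t ^ 2 < 1) by nra.
  assert (exp t ^ 2 * N t th < 1 * N t th) by (apply Rmult_lt_compat_r; assumption).
  apply Rlt_div_r; nra.
Qed.

End Starlike_order_half.

(** * Subordination to [qt alpha] and the bound [gamma alpha] *)

(** The denominator is [D = 3 - w (3 - alpha + alpha w)]. For [0 <= alpha <= 1] and [|w| < 1] the
    bracket has modulus at most 3, so [|D - 3| < 3], which is equivalent to [Re (3 / D) > 1/2]. *)
Lemma Re_half_of_subordinate (alpha : R) (F : C -> C) (z : C) :
  0 <= alpha <= 1 -> subordinate F (qt alpha) -> in_disc z -> / 2 < Re (F z).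
Proof.
  intros Ha (_ & _ & w & _ & Hw & _ & HF) Hz.
  rewrite (HF z Hz); specialize (Hw z Hz).
  destruct (w z) as [x y].
  unfold in_disc in Hw.
  assert (Hn : x ^ 2 + y ^ 2 < 1).
  { unfold Cmod in Hw; cbn [fst snd] in Hw.
    rewrite <- sqrt_1 in Hw; apply sqrt_lt_0_alt in Hw; exact Hw. }
  set (D1 := 3 + (alpha - 3) * x - alpha * (x ^ 2 - y ^ 2)).
  set (D2 := (alpha - 3) * y - 2 * alpha * x * y).
  assert (HD : qt alpha (x, y) = Cdiv (RtoC 3) (D1, D2)).
  { unfold qt; f_equal; apply injective_projections; unfold D1, D2; cbn; ring. }
  (* [Re (3 / D) > 1/2] means [|D|^2 < 6 Re D]. *)
  assert (Key : 6 * D1 - (D1 ^ 2 + D2 ^ 2)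
    = 9 - (x ^ 2 + y ^ 2) * ((3 - alpha + alpha * x) ^ 2 + (alpha * y) ^ 2))
    by (unfold D1, D2; ring).
  assert (Hx : - 1 <= x <= 1) by (split; nra).
  assert (Hb : (3 - alpha + alpha * x) ^ 2 + (alpha * y) ^ 2 <= 9).
  { assert (H0 : (3 - alpha + alpha * x) ^ 2 + (alpha * y) ^ 2
      = (3 - alpha) ^ 2 + 2 * alpha * (3 - alpha) * x + alpha ^ 2 * (x ^ 2 + y ^ 2))
      by ring.
    assert (alpha * (3 - alpha) * x <= alpha * (3 - alpha) * 1)
      by (apply Rmult_le_compat_l; nra).
    assert (alpha ^ 2 * (x ^ 2 + y ^ 2) <= alpha ^ 2 * 1)
      by (apply Rmult_le_compat_l; nra).
    lra. }
  assert (Hpos : 0 < 6 * D1 - (D1 ^ 2 + D2 ^ 2)).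
  { rewrite Key.
    destruct (Rle_lt_dec (x ^ 2 + y ^ 2) 0) as [H0|H0].
    - assert (x ^ 2 + y ^ 2 = 0) as -> by nra; lra.
    - nra. }
  assert (HD0 : 0 < D1 ^ 2 + D2 ^ 2) by nra.
  rewrite HD.
  replace (Re (Cdiv (RtoC 3) (D1, D2))) with (3 * D1 / (D1 ^ 2 + D2 ^ 2))
    by (unfold Re, Cdiv, Cinv; cbn; field;
        apply Rgt_not_eq; replace (D1 * D1 + D2 * D2) with (D1 ^ 2 + D2 ^ 2) by ring;
        exact HD0).
  apply Rlt_div_r; lra.
Qed.

(** Clearing denominators leaves [alpha ^ 2 <= 3 * alpha], with equality at [alpha = 0]. *)
Lemma gamma_le_half (alpha : R) : 0 <= alpha <= 1 -> gamma alpha <= / 2.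
Proof.
  intros Ha; unfold gamma.
  apply Rle_div_l; nra.
Qed.

Theorem theorem2p1 (alpha : R) (f : C -> C) :
  0 <= alpha <= 1 -> SK alpha f ->
  forall z : C, in_disc z -> Re (f_over_z f z) > gamma alpha.
Proof.
  intros Ha (f' & Hf & f0 & f'0 & Hsub) z Hz.
  pose proof (gamma_le_half alpha Ha) as Hg.
  unfold f_over_z; destruct (Ceq_dec z 0) as [|Hz0]; [cbn; lra|].
  eapply Rle_lt_trans; [exact Hg|].
  set (P := zfp_over_f f f').
  assert (HP2 : forall z, in_disc z -> / 2 < Re (P z))
    by (intros; apply (Re_half_of_subordinate alpha); assumption).
  assert (HPz : forall v : C, v <> 0 -> P v = (v * f' v / f v)%C).
  { intros v Hv; unfold P, zfp_over_f; destruct (Ceq_dec v 0); [contradiction|reflexivity]. }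
  assert (Hfz : forall z, in_disc z -> z <> 0 -> f z <> 0).
  { intros v Hv Hv0 E.
    specialize (HP2 v Hv); rewrite HPz, E in HP2 by assumption.
    (* [x / 0 = 0] in [C], so [P v] would be 0. *)
    replace (v * f' v / 0)%C with (RtoC 0) in HP2; [cbn in HP2; lra|].
    unfold Cdiv; replace (/ 0)%C with (RtoC 0); [ring|].
    apply injective_projections; cbn; unfold Rdiv; ring. }
  (* Analyticity of [P], including at the patched point 0, is part of [subordinate]; the existential
     is made total so that [choice] yields a derivative function. *)
  assert (HP' : forall v, exists l, in_disc v -> Cis_derive P v l).
  { intros v; destruct (classic (in_disc v)) as [Hv|Hv].
    - destruct (proj1 Hsub v Hv) as [l Hl]; exists l; auto.
    - exists 0; tauto. }
  destruct (choice _ HP') as [P' HP'd].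
  apply (Re_f_over_z_half f f' P P'); auto.
  - unfold P, zfp_over_f; destruct (Ceq_dec 0 0); [reflexivity|contradiction].
  - intros v Hv Hv0; rewrite HPz by assumption; field; auto.
Qed.
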